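(* Let $\alpha>0$, let $N\geq 2$ be an integer and let $\mathcal{D}=(\mathrm{D}+\alpha\,\mathrm{Id})^N$ act on $1$-periodic generalized functions. Let $L\ge 1$, $\beta_1,\dots,\beta_L\in\mathbb{R}$, $\theta_1,\dots,\theta_L\in\mathbb{T}$. If the (continuous) $\mathcal{D}$-spline $f=\sum_{\ell=1}^L\beta_\ell\,\psi_{\mathcal{D}}(\cdot-\theta_\ell)$ satisfies $\|f\|_\infty=1$, then $f$ admits a finite number $P$ of saturation points, i.e. of points $t\in\mathbb{T}$ such that $|f(t)|=1$, and $P\leq LN$.
   Context: The period is $1$, $\mathbb{T}=[0,1]$ with endpoints identified. $\mathcal{S}'(\mathbb{T})$ is the space of $1$-periodic generalized functions, $\mathrm{D}$ the derivative in the sense of periodic distributions, $\mathrm{Id}$ the identity, $\text{Ш}=\sum_{i\in\mathbb{Z}}\delta(\cdot-i)$ the $1$-periodic Dirac comb. The operator $\mathcal{D}$ is invertible on $\mathcal{S}'(\mathbb{T})$ and its Green's function is $\psi_{\mathcal{D}}=\mathcal{D}^{-1}\{\text{Ш}\}$, the unique periodic generalized function with $\mathcal{D}\psi_{\mathcal{D}}=\text{Ш}$; for $N\ge2$ it is a continuous function. A $\mathcal{D}$-spline is an $f\in\mathcal{S}'(\mathbb{T})$ such that $\mathcal{D}f=\sum_{\ell=1}^L\beta_\ell\,\text{Ш}(\cdot-\theta_\ell)$, equivalently $f=\sum_{\ell=1}^L\beta_\ell\,\psi_{\mathcal{D}}(\cdot-\theta_\ell)$. $\|f\|_\infty=\sup_{t\in\mathbb{T}}|f(t)|$.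 *)

(* Defs.v *)
From Stdlib Require Export Reals Lra Lia List.
From Stdlib Require Import FunctionalExtensionality ProofIrrelevance ClassicalEpsilon.
From Coquelicot Require Export Coquelicot.
Open Scope R_scope.

(** The circle [T = [0,1]] with endpoints identified is represented by the
    fundamental domain [0 <= t < 1], and functions on it by 1-periodic
    functions on [R]. *)

Definition in_T (t : R) : Prop := 0 <= t < 1.

Definition periodic1 (f : R -> R) : Prop := forall x, f (x + 1) = f x.

(** * Periodic test functions: the space S(T) *)

Record ptest := PTest {
  pt_fun :> R -> R;
  pt_smooth : forall n x, ex_derive_n pt_fun n x;
  pt_per : periodic1 pt_fun
}.

Lemma pt_ext (p q : ptest) : (forall x, p x = q x) -> p = q.
Proof.
  destruct p as [f sf pf], q as [g sg pg]; simpl; intros H.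
  assert (E : f = g) by (apply functional_extensionality; exact H).
  subst g. f_equal; apply proof_irrelevance.
Qed.

Lemma pt_ex_derive (p : ptest) x : ex_derive p x.
Proof. exact (pt_smooth p 1 x). Qed.

Lemma pt_continuous (p : ptest) x : continuous p x.
Proof. apply (ex_derive_continuous (V := R_NormedModule)), pt_ex_derive. Qed.

Lemma derive_n_per (f : R -> R) n : periodic1 f -> periodic1 (Derive_n f n).
Proof.
  intros H x. rewrite <- Derive_n_comp_trans.
  apply Derive_n_ext; intros t; apply H.
Qed.

Lemma pt_plus_smooth (p q : ptest) n x : ex_derive_n (fun t => p t + q t) n x.
Proof.
  apply ex_derive_n_plus; apply filter_forall; intros; apply pt_smooth.
Qed.

Lemma pt_plus_per (p q : ptest) : periodic1 (fun t => p t + q t).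
Proof. intros x. now rewrite !pt_per. Qed.

Definition pt_plus (p q : ptest) : ptest :=
  PTest (fun t => p t + q t) (pt_plus_smooth p q) (pt_plus_per p q).

Lemma pt_scal_smooth (a : R) (p : ptest) n x : ex_derive_n (fun t => a * p t) n x.
Proof. apply ex_derive_n_scal_l, pt_smooth. Qed.

Lemma pt_scal_per (a : R) (p : ptest) : periodic1 (fun t => a * p t).
Proof. intros x. now rewrite !pt_per. Qed.

Definition pt_scal (a : R) (p : ptest) : ptest :=
  PTest (fun t => a * p t) (pt_scal_smooth a p) (pt_scal_per a p).

Lemma pt_derive_smooth (p : ptest) n x : ex_derive_n (Derive p) n x.
Proof.
  destruct n as [|n]; [exact I|]. simpl.
  apply (ex_derive_ext (Derive_n p (S n))).
  - intros t. rewrite (Derive_n_comp p n 1). now rewrite Nat.add_1_r.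
  - exact (pt_smooth p (S (S n)) x).
Qed.

Lemma pt_derive_per (p : ptest) : periodic1 (Derive p).
Proof. exact (derive_n_per p 1 (pt_per p)). Qed.

Definition pt_derive (p : ptest) : ptest :=
  PTest (Derive p) (pt_derive_smooth p) (pt_derive_per p).

Lemma pt_shift_smooth (th : R) (p : ptest) n x : ex_derive_n (fun t => p (t + th)) n x.
Proof. apply ex_derive_n_comp_trans, pt_smooth. Qed.

Lemma pt_shift_per (th : R) (p : ptest) : periodic1 (fun t => p (t + th)).
Proof.
  intros x. replace (x + 1 + th) with (x + th + 1) by ring. apply pt_per.
Qed.

Definition pt_shift (th : R) (p : ptest) : ptest :=
  PTest (fun t => p (t + th)) (pt_shift_smooth th p) (pt_shift_per th p).

(** * Periodic generalized functions: the topological dual S'(T) *)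

Definition pt_linear (u : ptest -> R) : Prop :=
  (forall p q, u (pt_plus p q) = u p + u q) /\
  (forall a p, u (pt_scal a p) = a * u p).

(** [M] bounds the derivatives of [p] of order at most [m] in supremum norm. *)
Definition pt_bounded_by (m : nat) (M : R) (p : ptest) : Prop :=
  forall k x, (k <= m)%nat -> Rabs (Derive_n p k x) <= M.

(** Continuity for the Fréchet topology defined by the norms
    [max_{k <= m} sup |p^(k)|]. *)
Definition pt_cont (u : ptest -> R) : Prop :=
  exists (C : R) (m : nat), forall p M, pt_bounded_by m M p -> Rabs (u p) <= C * M.

Record pdist := PDist {
  pd_fun :> ptest -> R;
  pd_linear : pt_linear pd_fun;
  pd_cont : pt_cont pd_fun
}.

Lemma pd_ext (u v : pdist) : (forall p, u p = v p) -> u = v.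
Proof.
  destruct u as [f lf cf], v as [g lg cg]; simpl; intros H.
  assert (E : f = g) by (apply functional_extensionality; exact H).
  subst g. f_equal; apply proof_irrelevance.
Qed.

(** ** Vector space structure *)

Lemma pd_zero_lin : pt_linear (fun _ => 0).
Proof. split; intros; ring. Qed.
Lemma pd_zero_cont : pt_cont (fun _ => 0).
Proof. exists 0, O. intros p M _. rewrite Rabs_R0. lra. Qed.
Definition pd_zero : pdist := PDist _ pd_zero_lin pd_zero_cont.

Lemma pd_plus_lin (u v : pdist) : pt_linear (fun p => u p + v p).
Proof.
  destruct (pd_linear u) as [u1 u2], (pd_linear v) as [v1 v2].
  split; intros; rewrite ?u1, ?u2, ?v1, ?v2; ring.
Qed.
Lemma pd_plus_cont (u v : pdist) : pt_cont (fun p => u p + v p).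
Proof.
  destruct (pd_cont u) as (C1 & m1 & H1), (pd_cont v) as (C2 & m2 & H2).
  exists (C1 + C2), (Nat.max m1 m2). intros p M H.
  apply Rle_trans with (1 := Rabs_triang _ _). rewrite Rmult_plus_distr_r.
  apply Rplus_le_compat; [apply H1 | apply H2]; intros k x Hk; apply H; lia.
Qed.
Definition pd_plus (u v : pdist) : pdist := PDist _ (pd_plus_lin u v) (pd_plus_cont u v).

Lemma pd_scal_lin (a : R) (u : pdist) : pt_linear (fun p => a * u p).
Proof.
  destruct (pd_linear u) as [u1 u2].
  split; intros; rewrite ?u1, ?u2; ring.
Qed.
Lemma pd_scal_cont (a : R) (u : pdist) : pt_cont (fun p => a * u p).
Proof.
  destruct (pd_cont u) as (C & m & H).
  exists (Rabs a * C), m. intros p M Hp. rewrite Rabs_mult, Rmult_assoc.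
  apply Rmult_le_compat_l; [apply Rabs_pos | now apply H].
Qed.
Definition pd_scal (a : R) (u : pdist) : pdist := PDist _ (pd_scal_lin a u) (pd_scal_cont a u).

Definition pd_opp (u : pdist) : pdist := pd_scal (-1) u.

Definition pdist_AbelianMonoid_mixin : AbelianMonoid.mixin_of pdist.
Proof.
  apply (AbelianMonoid.Mixin pdist pd_plus pd_zero);
    intros; apply pd_ext; intros; simpl; ring.
Defined.

Canonical pdist_AbelianMonoid : AbelianMonoid :=
  AbelianMonoid.Pack pdist pdist_AbelianMonoid_mixin pdist.

Definition pdist_AbelianGroup_mixin : AbelianGroup.mixin_of pdist_AbelianMonoid.
Proof.
  apply (AbelianGroup.Mixin pdist_AbelianMonoid pd_opp);
    intros; apply pd_ext; intros; simpl; ring.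
Defined.

Definition pdist_AbelianGroup_class : AbelianGroup.class_of pdist :=
  AbelianGroup.Class pdist pdist_AbelianMonoid_mixin pdist_AbelianGroup_mixin.

Canonical pdist_AbelianGroup : AbelianGroup :=
  AbelianGroup.Pack pdist pdist_AbelianGroup_class pdist.

Definition pdist_ModuleSpace_mixin : ModuleSpace.mixin_of R_Ring pdist_AbelianGroup.
Proof.
  apply (ModuleSpace.Mixin R_Ring pdist_AbelianGroup pd_scal);
    intros; apply pd_ext; intros; simpl; unfold mult, plus, one; simpl; ring.
Defined.

Canonical pdist_ModuleSpace : ModuleSpace R_Ring :=
  ModuleSpace.Pack R_Ring pdist
    (ModuleSpace.Class R_Ring pdist pdist_AbelianGroup_class pdist_ModuleSpace_mixin) pdist.

(** ** Differentiation, translation, Dirac comb *)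

Lemma pd_derive_lin (u : pdist) : pt_linear (fun p => - u (pt_derive p)).
Proof.
  destruct (pd_linear u) as [u1 u2]. split.
  - intros p q.
    replace (pt_derive (pt_plus p q)) with (pt_plus (pt_derive p) (pt_derive q)).
    { rewrite u1. ring. }
    apply pt_ext; intros x; simpl. symmetry. apply Derive_plus; apply pt_ex_derive.
  - intros a p.
    replace (pt_derive (pt_scal a p)) with (pt_scal a (pt_derive p)).
    { rewrite u2. ring. }
    apply pt_ext; intros x; simpl. symmetry. apply Derive_scal.
Qed.

Lemma pd_derive_cont (u : pdist) : pt_cont (fun p => - u (pt_derive p)).
Proof.
  destruct (pd_cont u) as (C & m & H).
  exists C, (S m). intros p M Hp. rewrite Rabs_Ropp. apply H.
  intros k x Hk. simpl. change (Derive p) with (Derive_n p 1).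
  rewrite Derive_n_comp. apply Hp. lia.
Qed.

(** The distributional derivative [D]. *)
Definition pd_derive (u : pdist) : pdist := PDist _ (pd_derive_lin u) (pd_derive_cont u).

Lemma pd_translate_lin (th : R) (u : pdist) : pt_linear (fun p => u (pt_shift th p)).
Proof.
  destruct (pd_linear u) as [u1 u2]. split.
  - intros p q. rewrite <- u1. f_equal. now apply pt_ext.
  - intros a p. rewrite <- u2. f_equal. now apply pt_ext.
Qed.

Lemma pd_translate_cont (th : R) (u : pdist) : pt_cont (fun p => u (pt_shift th p)).
Proof.
  destruct (pd_cont u) as (C & m & H).
  exists C, m. intros p M Hp. apply H. intros k x Hk. simpl.
  rewrite Derive_n_comp_trans. now apply Hp.
Qed.

(** [pd_translate th u] is [u(. - th)]. *)
Definition pd_translate (th : R) (u : pdist) : pdist :=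
  PDist _ (pd_translate_lin th u) (pd_translate_cont th u).

Lemma dirac_comb_lin : pt_linear (fun p => p 0).
Proof. split; reflexivity. Qed.
Lemma dirac_comb_cont : pt_cont (fun p => p 0).
Proof. exists 1, O. intros p M Hp. rewrite Rmult_1_l. exact (Hp O 0 (le_n 0)). Qed.

(** The comb [sum_i delta(. - i)]: one period carries exactly one Dirac mass,
    so on periodic test functions it acts as evaluation at [0]. *)
Definition dirac_comb : pdist := PDist _ dirac_comb_lin dirac_comb_cont.

(** ** Continuous periodic functions as generalized functions *)

Record pcont := PCont {
  pc_fun :> R -> R;
  pc_cont : forall x, continuous pc_fun x;
  pc_per : periodic1 pc_fun
}.

Lemma pc_ex_RInt (f : pcont) (p : ptest) : ex_RInt (fun t => f t * p t) 0 1.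
Proof.
  apply (ex_RInt_continuous (V := R_CompleteNormedModule)). intros x _.
  apply (continuous_mult (K := R_AbsRing)); [apply pc_cont | apply pt_continuous].
Qed.

Lemma pd_of_fun_lin (f : pcont) : pt_linear (fun p => RInt (fun t => f t * p t) 0 1).
Proof.
  split.
  - intros p q. transitivity (RInt (fun t => plus (f t * p t) (f t * q t)) 0 1).
    { apply RInt_ext; intros x _; simpl; unfold plus; simpl; ring. }
    rewrite (RInt_plus (V := R_CompleteNormedModule)); [reflexivity | apply pc_ex_RInt | apply pc_ex_RInt].
  - intros a p. transitivity (RInt (fun t => scal a (f t * p t)) 0 1).
    { apply RInt_ext; intros x _; simpl; unfold scal; simpl; unfold mult; simpl; ring. }
    rewrite (RInt_scal (V := R_CompleteNormedModule)); [reflexivity | apply pc_ex_RInt].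
Qed.

Lemma pd_of_fun_cont (f : pcont) : pt_cont (fun p => RInt (fun t => f t * p t) 0 1).
Proof.
  assert (Hf : forall x, continuous (fun t => Rabs (f t)) x).
  { intros x. apply continuous_comp; [apply pc_cont | apply continuous_Rabs]. }
  assert (If : ex_RInt (fun t => Rabs (f t)) 0 1).
  { apply (ex_RInt_continuous (V := R_CompleteNormedModule)). intros; apply Hf. }
  exists (RInt (fun t => Rabs (f t)) 0 1), O. intros p M Hp.
  apply Rle_trans with (RInt (fun t => Rabs (f t * p t)) 0 1).
  { apply abs_RInt_le; [lra | apply pc_ex_RInt]. }
  replace (RInt (fun t => Rabs (f t)) 0 1 * M)
    with (RInt (fun t => scal M (Rabs (f t))) 0 1).
  - apply RInt_le; [lra | | |].
    + apply (ex_RInt_continuous (V := R_CompleteNormedModule)). intros x _.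
      apply (continuous_comp (fun t => f t * p t) Rabs); [|apply continuous_Rabs].
      apply (continuous_mult (K := R_AbsRing)); [apply pc_cont | apply pt_continuous].
    + now apply (ex_RInt_scal (V := R_NormedModule)).
    + intros x _. rewrite Rabs_mult, Rmult_comm. unfold scal; simpl; unfold mult; simpl.
      apply Rmult_le_compat_r; [apply Rabs_pos | exact (Hp O x (le_n 0))].
  - rewrite (RInt_scal (V := R_CompleteNormedModule)) by exact If. apply Rmult_comm.
Qed.

Definition pd_of_fun (f : pcont) : pdist := PDist _ (pd_of_fun_lin f) (pd_of_fun_cont f).

(** * The operator [(D + alpha Id)^N], its inverse and its Green's function *)

Definition Dop1 (alpha : R) (u : pdist) : pdist :=
  plus (pd_derive u) (scal alpha u).

Definition Dop (alpha : R) (N : nat) : pdist -> pdist :=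
  Nat.iter N (Dop1 alpha).

(** The inverse of [Dop alpha N], a genuine inverse when [0 < alpha] by
    [Dop_bijective] below. *)
Definition Dop_inv (alpha : R) (N : nat) (u : pdist) : pdist :=
  epsilon (inhabits pd_zero) (fun v => Dop alpha N v = u).

Definition green (alpha : R) (N : nat) : pdist := Dop_inv alpha N dirac_comb.

(** * Supremum norm over [T] and saturation points *)

Definition sup_norm (f : R -> R) : Rbar :=
  Lub_Rbar (fun y => exists t, in_T t /\ y = Rabs (f t)).

Definition saturation (f : R -> R) (t : R) : Prop := in_T t /\ Rabs (f t) = 1.

(** * Invertibility of [Dop]

    The transpose of [D + alpha Id] is [p |-> alpha p - p'].  It is inverted on
    test functions by solving [x' = alpha x - p] with periodic [x]. *)

Lemma adj_bound_aux (alpha M : R) (x p : R -> R) : 0 < alpha ->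
  (forall t, is_derive x t (alpha * x t - p t)) -> periodic1 x ->
  (forall t, p t <= M) -> forall t, x t <= M / alpha.
Proof.
  intros Ha Hx Px Hp t.
  set (h := fun s => exp (- alpha * s) * (x s - M / alpha)).
  assert (Hh : forall s, is_derive h s (exp (- alpha * s) * (M - p s))).
  { intros s. unfold h.
    evar_last.
    { apply (is_derive_mult (fun s => exp (- alpha * s)) (fun s => x s - M / alpha)).
      - apply is_derive_comp; [apply is_derive_exp|].
        apply (is_derive_scal (fun s => s)), is_derive_id.
      - apply (is_derive_minus (V := R_NormedModule));
          [apply Hx | apply (is_derive_const (V := R_NormedModule))].
      - intros; apply Rmult_comm. }
    unfold plus, mult, scal, minus, opp, plus, zero, one; simpl.
    unfold mult; simpl. unfold one; simpl. field. lra. }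
  destruct (MVT_gen h t (t + 1) (fun s => exp (- alpha * s) * (M - p s)))
    as (c & _ & Hc).
  { intros; apply Hh. }
  { intros s _. apply continuity_pt_filterlim.
    apply (ex_derive_continuous (V := R_NormedModule)). eexists; apply Hh. }
  assert (H1 : h t <= h (t + 1)).
  { assert (0 <= exp (- alpha * c) * (M - p c)).
    { apply Rmult_le_pos; [left; apply exp_pos | specialize (Hp c); lra]. }
    nra. }
  unfold h in H1. rewrite Px in H1.
  replace (- alpha * (t + 1)) with (- alpha * t + - alpha) in H1 by ring.
  rewrite exp_plus in H1.
  assert (E1 : exp (- alpha) < 1).
  { rewrite <- exp_0. apply exp_increasing. lra. }
  pose proof (exp_pos (- alpha * t)) as E2.
  set (e := exp (- alpha)) in *. set (E := exp (- alpha * t)) in *.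
  destruct (Rle_lt_dec (x t) (M / alpha)) as [|Hlt]; [assumption|exfalso].
  assert (0 < (1 - e) * (E * (x t - M / alpha))).
  { apply Rmult_lt_0_compat; [lra|]. apply Rmult_lt_0_compat; lra. }
  nra.
Qed.

Lemma adj_bound (alpha M : R) (x p : R -> R) : 0 < alpha ->
  (forall t, is_derive x t (alpha * x t - p t)) -> periodic1 x ->
  (forall t, Rabs (p t) <= M) -> forall t, Rabs (x t) <= M / alpha.
Proof.
  intros Ha Hx Px Hp t. apply Rabs_le. split.
  - assert (- x t <= M / alpha); [|lra].
    apply (adj_bound_aux alpha M (fun s => - x s) (fun s => - p s)); [assumption| | |].
    + intros s. replace (alpha * - x s - - p s) with (opp (alpha * x s - p s))
        by (unfold opp; simpl; ring).
      apply (is_derive_opp (V := R_NormedModule)), Hx.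
    + intros s. now rewrite Px.
    + intros s. specialize (Hp s). apply Rabs_le_between in Hp. lra.
  - apply (adj_bound_aux alpha M x p); try assumption.
    intros s. specialize (Hp s). apply Rabs_le_between in Hp. lra.
Qed.

Section AdjointInverse.
Variables (alpha : R) (Ha : 0 < alpha).

Definition adj_int (p : ptest) (t : R) : R := RInt (fun s => exp (- alpha * s) * p s) 0 t.

Definition adj_sol (p : ptest) (t : R) : R :=
  exp (alpha * t) * (exp alpha * adj_int p 1 / (exp alpha - 1) - adj_int p t).

Lemma adj_integrand_cont (p : ptest) s : continuous (fun s => exp (- alpha * s) * p s) s.
Proof.
  apply (continuous_mult (K := R_AbsRing)); [|apply pt_continuous].
  apply (ex_derive_continuous (V := R_NormedModule)). auto_derive; trivial.
Qed.

Lemma adj_ex_RInt (p : ptest) a b : ex_RInt (fun s => exp (- alpha * s) * p s) a b.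
Proof.
  apply (ex_RInt_continuous (V := R_CompleteNormedModule)).
  intros; apply adj_integrand_cont.
Qed.

Lemma adj_int_derive (p : ptest) t : is_derive (adj_int p) t (exp (- alpha * t) * p t).
Proof.
  apply (is_derive_RInt (fun s => exp (- alpha * s) * p s) (adj_int p) 0).
  - apply filter_forall. intros s. apply (RInt_correct (V := R_CompleteNormedModule)).
    apply adj_ex_RInt.
  - apply adj_integrand_cont.
Qed.

Lemma adj_sol_derive (p : ptest) t :
  is_derive (adj_sol p) t (alpha * adj_sol p t - p t).
Proof.
  unfold adj_sol. set (c := exp alpha * adj_int p 1 / (exp alpha - 1)).
  evar_last.
  { apply (is_derive_mult (fun t => exp (alpha * t)) (fun t => c - adj_int p t)).
    - apply is_derive_comp; [apply is_derive_exp|].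
      apply (is_derive_scal (fun s => s)), is_derive_id.
    - apply (is_derive_minus (V := R_NormedModule));
        [apply (is_derive_const (V := R_NormedModule)) | apply adj_int_derive].
    - intros; apply Rmult_comm. }
  unfold plus, mult, scal, minus, opp, plus, zero, one; simpl.
  unfold mult; simpl. unfold one; simpl.
  replace (- alpha * t) with (- (alpha * t)) by ring. rewrite exp_Ropp.
  field. apply Rgt_not_eq, exp_pos.
Qed.

Lemma adj_int_shift (p : ptest) t :
  adj_int p (t + 1) = adj_int p 1 + exp (- alpha) * adj_int p t.
Proof.
  unfold adj_int.
  rewrite <- (RInt_Chasles (V := R_CompleteNormedModule)
               (fun s => exp (- alpha * s) * p s) 0 1 (t + 1)) by apply adj_ex_RInt.
  unfold plus; simpl. f_equal.
  transitivity (RInt (fun s => scal (exp (- alpha)) (exp (- alpha * s) * p s)) 0 t).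
  - replace 1 with (1 * 0 + 1) at 1 by ring.
    replace (t + 1) with (1 * t + 1) by ring.
    rewrite <- (RInt_comp_lin (V := R_CompleteNormedModule)
               (fun s => exp (- alpha * s) * p s) 1 1 0 t) by apply adj_ex_RInt.
    apply RInt_ext. intros s _. unfold scal; simpl; unfold mult; simpl.
    rewrite Rmult_1_l. rewrite pt_per, Rmult_1_l.
    replace (- alpha * (s + 1)) with (- alpha + - alpha * s) by ring.
    rewrite exp_plus. ring.
  - rewrite (RInt_scal (V := R_CompleteNormedModule)) by apply adj_ex_RInt. reflexivity.
Qed.

Lemma adj_sol_per (p : ptest) : periodic1 (adj_sol p).
Proof.
  intros t. unfold adj_sol. rewrite adj_int_shift.
  replace (alpha * (t + 1)) with (alpha * t + alpha) by ring.
  rewrite exp_plus, exp_Ropp.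
  assert (1 < exp alpha) by (rewrite <- exp_0; now apply exp_increasing).
  field. split; lra.
Qed.

Lemma adj_sol_smooth_aux (p : ptest) n :
  (forall t, ex_derive_n (adj_sol p) n t) /\
  (forall t, is_derive (Derive_n (adj_sol p) n) t
               (alpha * Derive_n (adj_sol p) n t - Derive_n p n t)).
Proof.
  induction n as [|n [IH1 IH2]].
  - split; [intros; exact I | intros t; apply adj_sol_derive].
  - split.
    + intros t. eexists. apply IH2.
    + intros t.
      apply (is_derive_ext
        (fun t => alpha * Derive_n (adj_sol p) n t - Derive_n p n t)).
      { intros s. symmetry. simpl. apply is_derive_unique, IH2. }
      apply (is_derive_minus (V := R_NormedModule)
               (fun t => alpha * Derive_n (adj_sol p) n t) (Derive_n p n)).
      * apply is_derive_scal, Derive_correct. eexists; apply IH2.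
      * apply Derive_correct. exact (pt_smooth p (S n) t).
Qed.

Definition adj_inv (p : ptest) : ptest :=
  PTest (adj_sol p) (fun n t => proj1 (adj_sol_smooth_aux p n) t) (adj_sol_per p).

Lemma adj_unique (x : ptest) (p : R -> R) (y : R -> R) :
  (forall t, is_derive x t (alpha * x t - p t)) ->
  (forall t, is_derive y t (alpha * y t - p t)) -> periodic1 y ->
  forall t, x t = y t.
Proof.
  intros Hx Hy Py t.
  assert (H : Rabs (x t - y t) <= 0 / alpha).
  { apply (adj_bound alpha 0 (fun t => x t - y t) (fun _ => 0)); [assumption| | |].
    - intros s. replace (alpha * (x s - y s) - 0)
        with (minus (alpha * x s - p s) (alpha * y s - p s))
        by (unfold minus, plus, opp; simpl; ring).
      apply (is_derive_minus (V := R_NormedModule)); auto.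
    - intros s. now rewrite pt_per, Py.
    - intros s. rewrite Rabs_R0. lra. }
  replace (0 / alpha) with 0 in H by (field; lra).
  apply Rabs_le_between in H. lra.
Qed.

Lemma pd_adj_lin (u : pdist) : pt_linear (fun p => u (adj_inv p)).
Proof.
  destruct (pd_linear u) as [u1 u2]. split.
  - intros p q. rewrite <- u1. f_equal. apply pt_ext.
    apply (adj_unique _ (pt_plus p q)); [apply adj_sol_derive| |].
    + intros t. simpl.
      replace (alpha * (adj_sol p t + adj_sol q t) - (p t + q t))
        with (plus (alpha * adj_sol p t - p t) (alpha * adj_sol q t - q t))
        by (unfold plus; simpl; ring).
      apply (is_derive_plus (V := R_NormedModule)); apply adj_sol_derive.
    + apply pt_per.
  - intros a p. rewrite <- u2. f_equal. apply pt_ext.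
    apply (adj_unique _ (pt_scal a p)); [apply adj_sol_derive| |].
    + intros t. simpl.
      replace (alpha * (a * adj_sol p t) - a * p t)
        with (a * (alpha * adj_sol p t - p t)) by ring.
      apply is_derive_scal, adj_sol_derive.
    + apply pt_per.
Qed.

Lemma pd_adj_cont (u : pdist) : pt_cont (fun p => u (adj_inv p)).
Proof.
  destruct (pd_cont u) as (C & m & H).
  exists (C / alpha), m. intros p M Hp.
  replace (C / alpha * M) with (C * (M / alpha)) by (field; lra).
  apply H. intros k x Hk.
  apply (adj_bound alpha M _ (Derive_n p k)); [assumption| | |].
  - apply (proj2 (adj_sol_smooth_aux p k)).
  - apply derive_n_per, adj_sol_per.
  - intros t. now apply Hp.
Qed.

Definition Dop1_inv (u : pdist) : pdist := PDist _ (pd_adj_lin u) (pd_adj_cont u).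

Lemma Dop1_transpose (u : pdist) (p : ptest) :
  Dop1 alpha u p = u (pt_plus (pt_scal alpha p) (pt_scal (-1) (pt_derive p))).
Proof.
  destruct (pd_linear u) as [u1 u2]. rewrite u1, !u2.
  unfold Dop1, plus, scal; simpl. ring.
Qed.

Lemma Dop1_invK (u : pdist) : Dop1 alpha (Dop1_inv u) = u.
Proof.
  apply pd_ext; intros p. rewrite Dop1_transpose. simpl. f_equal. apply pt_ext.
  apply (adj_unique _ (pt_plus (pt_scal alpha p) (pt_scal (-1) (pt_derive p))));
    [apply adj_sol_derive | | apply pt_per].
  intros t. evar_last; [apply Derive_correct, pt_ex_derive | simpl; ring].
Qed.

Lemma Dop1K (u : pdist) : Dop1_inv (Dop1 alpha u) = u.
Proof.
  apply pd_ext; intros p. unfold Dop1_inv. cbn [pd_fun]. rewrite Dop1_transpose.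
  f_equal. apply pt_ext. intros t. simpl.
  rewrite (is_derive_unique _ _ _ (adj_sol_derive p t)). ring.
Qed.

End AdjointInverse.

Lemma Dop_bijective (alpha : R) (N : nat) : 0 < alpha ->
  forall u, exists! v, Dop alpha N v = u.
Proof.
  intros Ha u. exists (Nat.iter N (Dop1_inv alpha Ha) u). unfold Dop. split.
  - revert u. induction N as [|N IH]; intros u; [reflexivity|].
    rewrite Nat.iter_succ_r, Nat.iter_succ, Dop1_invK. apply IH.
  - intros v <-. revert v. induction N as [|N IH]; intros v; [reflexivity|].
    rewrite Nat.iter_succ_r, Nat.iter_succ, Dop1K. apply IH.
Qed.

Lemma Dop_invK (alpha : R) (N : nat) (u : pdist) : 0 < alpha ->
  Dop alpha N (Dop_inv alpha N u) = u.
Proof.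
  intros Ha. unfold Dop_inv. apply epsilon_spec.
  destruct (Dop_bijective alpha N Ha u) as (v & Hv & _). now exists v.
Qed.

(* Main.v *)
Require Import Defs.
From Stdlib Require Import Classical ClassicalEpsilon.

(** The knots cut the circle into at most [L] arcs, each closed at its left end,
    and each arc carries at most [N] saturation points.  On the open arc that
    starts at a knot, [f] is [exp (- alpha * s) * Q s], where [s] is the offset
    from the knot and [Q] is a polynomial of degree less than [N].  An interior
    saturation point is a local extremum, since [|f| <= 1], so it is a zero of
    [Q' - alpha * Q], again a polynomial of degree less than [N].  That
    polynomial is not zero: otherwise [Q' = alpha * Q], which forces [Q = 0] and
    leaves no saturation point.  So an open arc has at most [N - 1] of them
    ([arc_count]); the knot itself is the possible [N]-th.

    The form of [f] on an arc comes from an explicit kernel.  By repeated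
    integration by parts, the Green function acts on test functions as
    integration over one period against [exp (- alpha * s) * q s], where [q] is
    a polynomial of degree less than [N] ([green_kernel]).  For [N >= 2] this
    kernel takes equal values at both ends of the period, so its periodic
    translates are continuous; both sides of the spline identity are then
    continuous functions with the same integrals against all smooth periodic
    functions, hence equal pointwise ([test_functions_separate],
    [spline_formula]).

    The arcs are never enumerated in cyclic order.  A point belongs to the knot
    for which its offset, taken modulo 1, is least ([on_arc_cover]); the count
    then adds up over the knots, repeated knots doing no harm
    ([length_cover]). *)

(** * Functions with vanishing n-th derivative *)

(** Polynomials of degree less than [n], described by their derivatives: the
    closure properties and the antiderivatives needed for the Green function are
    then immediate, and coefficients appear only in the count of roots. *)
Fixpoint polyfun (n : nat) (p : R -> R) : Prop :=
  match n with
  | O => forall x, p x = 0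
  | S n => exists q, polyfun n q /\ forall x, is_derive p x (q x)
  end.

Lemma polyfun_ext n p q : (forall x, p x = q x) -> polyfun n p -> polyfun n q.
Proof.
  destruct n as [|n]; simpl; intros E H.
  - intros x. now rewrite <- E.
  - destruct H as (r & Hr & D). exists r; split; [exact Hr|]. intros x.
    now apply (is_derive_ext p).
Qed.

Lemma polyfun_plus n p q : polyfun n p -> polyfun n q -> polyfun n (fun x => p x + q x).
Proof.
  revert p q; induction n as [|n IH]; simpl; intros p q Hp Hq.
  - intros x. rewrite Hp, Hq. ring.
  - destruct Hp as (p' & Hp & Dp), Hq as (q' & Hq & Dq).
    exists (fun x => p' x + q' x). split; [auto|]. intros x.
    apply (is_derive_plus (V := R_NormedModule)); auto.
Qed.

Lemma polyfun_scal n a p : polyfun n p -> polyfun n (fun x => a * p x).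
Proof.
  revert p; induction n as [|n IH]; simpl; intros p Hp.
  - intros x. rewrite Hp. ring.
  - destruct Hp as (p' & Hp & Dp). exists (fun x => a * p' x). split; [auto|].
    intros x. now apply is_derive_scal.
Qed.

Lemma polyfun_shift n c p : polyfun n p -> polyfun n (fun x => p (x + c)).
Proof.
  revert p; induction n as [|n IH]; simpl; intros p Hp.
  - intros x. apply Hp.
  - destruct Hp as (p' & Hp & Dp). exists (fun x => p' (x + c)). split; [auto|].
    intros x. replace (p' (x + c)) with (scal 1 (p' (x + c))) by apply Rmult_1_l.
    apply (is_derive_comp p (fun x => x + c)); [apply Dp|].
    auto_derive; [trivial|ring].
Qed.

Lemma polyfun_S n p : polyfun n p -> polyfun (S n) p.
Proof.
  revert p; induction n as [|n IH]; intros p Hp.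
  - exists (fun _ => 0). split; [now intros x|]. intros x.
    apply (is_derive_ext (fun _ => 0)); [intros t; now rewrite Hp|].
    apply (is_derive_const (V := R_NormedModule)).
  - destruct Hp as (q & Hq & D). exists q. split; [now apply IH|exact D].
Qed.

Lemma polyfun_zero n : polyfun n (fun _ => 0).
Proof. induction n as [|n IH]; [now intros x|now apply polyfun_S]. Qed.

Lemma polyfun_derivable n p x : polyfun n p -> ex_derive p x.
Proof. intros H. apply polyfun_S in H. destruct H as (q & _ & D). now exists (q x). Qed.

Lemma polyfun_continuous n p x : polyfun n p -> continuous p x.
Proof.
  intros H. apply (ex_derive_continuous (V := R_NormedModule)).
  now apply (polyfun_derivable n).
Qed.

Lemma polyfun_sum n (a : nat -> R) (p : nat -> R -> R) L :
  (forall l, polyfun n (p l)) ->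
  polyfun n (fun x => sum_n_m (fun l => a l * p l x) 1 L).
Proof.
  intros H. induction L as [|L IH].
  - apply (polyfun_ext n (fun _ => 0)); [|apply polyfun_zero].
    intros x. rewrite sum_n_m_zero by lia. reflexivity.
  - apply (polyfun_ext n (fun x => sum_n_m (fun l => a l * p l x) 1 L + a (S L) * p (S L) x)).
    + intros x. rewrite sum_n_Sm by lia. reflexivity.
    + apply polyfun_plus; [exact IH|]. now apply polyfun_scal.
Qed.

(** An eigenfunction of the derivative for a nonzero eigenvalue is a multiple
    of its own derivatives, all the way down to the one that vanishes. *)
Lemma polyfun_eigen n a p : a <> 0 -> polyfun n p ->
  (forall x, is_derive p x (a * p x)) -> forall x, p x = 0.
Proof.
  intros Ha. revert p; induction n as [|n IH]; intros p Hp D; [exact Hp|].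
  destruct Hp as (q & Hq & Dq). apply IH; [|exact D].
  apply (polyfun_ext n (fun x => / a * q x)); [|now apply polyfun_scal].
  intros x. rewrite <- (is_derive_unique _ _ _ (Dq x)), (is_derive_unique _ _ _ (D x)).
  now field.
Qed.

Fixpoint horner (c : list R) (x : R) : R :=
  match c with nil => 0 | a :: c => a + x * horner c x end.

(** Synthetic division by [x - a]. *)
Lemma horner_divide c a : exists d, length d = pred (length c) /\
  forall x, horner c x = horner c a + (x - a) * horner d x.
Proof.
  induction c as [|b c (d & Ld & Hd)].
  - exists nil. split; [reflexivity|]. intros; simpl; ring.
  - destruct c as [|b' c].
    + exists nil. split; [reflexivity|]. intros; simpl; ring.
    + exists (horner (b' :: c) a :: d). split; [simpl in *; lia|].
      intros x. change (b + x * horner (b' :: c) x =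
        b + a * horner (b' :: c) a + (x - a) * (horner (b' :: c) a + x * horner d x)).
      rewrite (Hd x). ring.
Qed.

Lemma horner_roots rs : NoDup rs -> forall c, (length c <= length rs)%nat ->
  (forall r, In r rs -> horner c r = 0) -> forall x, horner c x = 0.
Proof.
  induction 1 as [|a rs Na Nd IH]; intros c Hc Hr x.
  - destruct c; [reflexivity|simpl in Hc; lia].
  - destruct (horner_divide c a) as (d & Ld & Hd).
    assert (E : horner c a = 0) by (apply Hr; now left).
    rewrite Hd, E, (IH d); [ring| simpl in Hc; lia |].
    intros r Ir. assert (Er := Hr r (or_intror Ir)). rewrite Hd, E in Er.
    assert (r <> a) by congruence.
    apply Rmult_eq_reg_l with (r - a); lra.
Qed.

(** Coefficients of [x ^ - (k + 1)] times the antiderivative, zero at 0, of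
    [x ^ k] times the polynomial [c]; the shift by [k] makes the recursion work, and only [k = 0]
    is of interest. *)
Fixpoint horner_int (k : nat) (c : list R) : list R :=
  match c with nil => nil | a :: c => a / INR (S k) :: horner_int (S k) c end.

Lemma horner_int_length c k : length (horner_int k c) = length c.
Proof. revert k; induction c; simpl; auto. Qed.

Lemma horner_int_derive c k x :
  is_derive (fun x => x ^ S k * horner (horner_int k c) x) x (x ^ k * horner c x).
Proof.
  revert k; induction c as [|a c IH]; intros k.
  - apply (is_derive_ext (fun _ => 0)); [intros; symmetry; apply Rmult_0_r|].
    simpl. rewrite Rmult_0_r. apply (is_derive_const (V := R_NormedModule)).
  - apply (is_derive_ext
      (fun x => a / INR (S k) * x ^ S k + x ^ S (S k) * horner (horner_int (S k) c) x)).
    { intros t. change (horner (horner_int k (a :: c)) t)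
        with (a / INR (S k) + t * horner (horner_int (S k) c) t).
      change (@eq R (a / INR (S k) * t ^ S k + t ^ S (S k) * horner (horner_int (S k) c) t)
        (t ^ S k * (a / INR (S k) + t * horner (horner_int (S k) c) t))).
      simpl pow. ring. }
    replace (x ^ k * horner (a :: c) x) with (a * x ^ k + x ^ S k * horner c x)
      by (simpl; ring).
    apply (is_derive_plus (V := R_NormedModule)); [|apply IH].
    auto_derive; [trivial|].
    change (match k with O => 1 | S _ => INR k + 1 end) with (INR (S k)).
    simpl pred. field. apply not_0_INR. lia.
Qed.

Lemma is_derive_zero_const (f : R -> R) : (forall x, is_derive f x 0) ->
  forall x, f x = f 0.
Proof.
  intros H x. destruct (MVT_gen f 0 x (fun _ => 0)) as (z & _ & Hz).
  - intros; apply H.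
  - intros t _. apply continuity_pt_filterlim.
    apply (ex_derive_continuous (V := R_NormedModule)). now exists 0.
  - lra.
Qed.

Lemma polyfun_horner n p : polyfun n p ->
  exists c, length c = n /\ forall x, p x = horner c x.
Proof.
  revert p; induction n as [|n IH]; intros p Hp.
  - exists nil. split; [reflexivity|exact Hp].
  - destruct Hp as (q & Hq & D). destruct (IH q Hq) as (c & Lc & Hc).
    exists (p 0 :: horner_int 0 c). split; [simpl; now rewrite horner_int_length, Lc|].
    intros x. simpl.
    assert (H : forall t, is_derive (fun t => p t - t * horner (horner_int 0 c) t) t 0).
    { intros t. replace 0 with (minus (q t) (t ^ 0 * horner c t))
        by (rewrite Hc; unfold minus, plus, opp; simpl; ring).
      apply (is_derive_minus (V := R_NormedModule) p
               (fun t => t * horner (horner_int 0 c) t)); [apply D|].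
      apply (is_derive_ext (fun t => t ^ 1 * horner (horner_int 0 c) t));
        [|apply horner_int_derive].
      intros s. now rewrite pow_1. }
    assert (E := is_derive_zero_const _ H x). simpl in E. lra.
Qed.

Lemma polyfun_roots n p rs : polyfun n p -> NoDup rs -> (n <= length rs)%nat ->
  (forall r, In r rs -> p r = 0) -> forall x, p x = 0.
Proof.
  intros Hp Nd Hl Hr x. destruct (polyfun_horner n p Hp) as (c & Lc & Hc).
  rewrite Hc. apply (horner_roots rs); [exact Nd|lia|].
  intros r Ir. rewrite <- Hc. auto.
Qed.

(** * Counting *)

(** A list of points of [P] that misses one can be extended, at most [n] times. *)
Lemma finite_of_bound (P : R -> Prop) n :
  (forall l, NoDup l -> (forall t, In t l -> P t) -> (length l <= n)%nat) ->
  exists l, NoDup l /\ (forall t, In t l <-> P t) /\ (length l <= n)%nat.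
Proof.
  intros B.
  assert (H : forall k l, NoDup l -> (forall t, In t l -> P t) -> (n < length l + k)%nat ->
    exists l, NoDup l /\ (forall t, In t l <-> P t)).
  { induction k as [|k IH]; intros l Nl Pl Hk.
    - specialize (B l Nl Pl). lia.
    - destruct (classic (exists t, P t /\ ~ In t l)) as [(t & Pt & Nt)|H].
      + apply (IH (t :: l)); [now constructor| |simpl; lia].
        intros s [<-|Hs]; auto.
      + exists l. split; [exact Nl|]. intros t. split; [apply Pl|].
        intros Pt. destruct (classic (In t l)) as [|Nt]; [assumption|].
        exfalso; apply H; now exists t. }
  destruct (H (S n) nil) as (l & Nl & Hl); [constructor|easy|simpl; lia|].
  exists l. split; [exact Nl|]. split; [exact Hl|]. apply B; [exact Nl|]. intros t; apply Hl.
Qed.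

Lemma length_cover (A : nat -> R -> Prop) n L ts :
  (forall l us, (1 <= l <= L)%nat -> NoDup us -> (forall t, In t us -> A l t) ->
     (length us <= n)%nat) ->
  NoDup ts -> (forall t, In t ts -> exists l, (1 <= l <= L)%nat /\ A l t) ->
  (length ts <= L * n)%nat.
Proof.
  revert ts; induction L as [|L IH]; intros ts B Nd C.
  - destruct ts as [|t ts]; [simpl; lia|].
    destruct (C t (or_introl eq_refl)) as (l & Hl & _). lia.
  - set (d := fun t => if excluded_middle_informative (A (S L) t) then true else false).
    assert (E := filter_length d ts).
    assert (H1 : (length (filter d ts) <= n)%nat).
    { apply (B (S L)); [lia|now apply NoDup_filter|].
      intros t [_ Ht]%filter_In. unfold d in Ht.
      now destruct (excluded_middle_informative (A (S L) t)). }
    assert (H2 : (length (filter (fun t => negb (d t)) ts) <= L * n)%nat).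
    { apply IH; [|now apply NoDup_filter|].
      - intros l us Hl. apply B. lia.
      - intros t [It Ht]%filter_In. destruct (C t It) as (l & Hl & Al).
        exists l. split; [|exact Al].
        destruct (Nat.eq_dec l (S L)) as [->|]; [exfalso|lia].
        unfold d in Ht. now destruct (excluded_middle_informative (A (S L) t)). }
    simpl. lia.
Qed.

Lemma argmin (u : nat -> R) L : (1 <= L)%nat ->
  exists l, (1 <= l <= L)%nat /\ forall m, (1 <= m <= L)%nat -> u l <= u m.
Proof.
  induction L as [|L IH]; intros HL; [lia|].
  destruct (Nat.eq_dec L 0) as [->|].
  - exists 1%nat. split; [lia|]. intros m Hm. replace m with 1%nat by lia. lra.
  - destruct IH as (l & Hl & Ml); [lia|].
    destruct (Rle_dec (u l) (u (S L))) as [H|H].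
    + exists l. split; [lia|]. intros m Hm.
      destruct (Nat.eq_dec m (S L)) as [->|]; [exact H|apply Ml; lia].
    + exists (S L). split; [lia|]. intros m Hm.
      destruct (Nat.eq_dec m (S L)) as [->|]; [lra|].
      specialize (Ml m ltac:(lia)). lra.
Qed.

(** * Separation of continuous functions by periodic test functions *)

(** A class of functions closed under differentiation, which makes all its members
    smooth without any formula for their higher derivatives. *)
Inductive smooth_expr (c : R) : (R -> R) -> Prop :=
| se_const a : smooth_expr c (fun _ => a)
| se_cos : smooth_expr c (fun t => cos (2 * PI * (t - c)))
| se_sin : smooth_expr c (fun t => sin (2 * PI * (t - c)))
| se_plus u v : smooth_expr c u -> smooth_expr c v -> smooth_expr c (fun t => u t + v t)
| se_mult u v : smooth_expr c u -> smooth_expr c v -> smooth_expr c (fun t => u t * v t)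
| se_exp u : smooth_expr c u -> smooth_expr c (fun t => exp (u t)).

Lemma smooth_expr_derive c u : smooth_expr c u ->
  exists v, smooth_expr c v /\ forall t, is_derive u t (v t).
Proof.
  induction 1 as [a| | |u v Hu (u' & Su & Du) Hv (v' & Sv & Dv)
                 |u v Hu (u' & Su & Du) Hv (v' & Sv & Dv)|u Hu (u' & Su & Du)].
  - exists (fun _ => 0). split; [constructor|]. intros t.
    apply (is_derive_const (V := R_NormedModule)).
  - exists (fun t => (- (2 * PI)) * sin (2 * PI * (t - c))). split; [repeat constructor|].
    intros t. auto_derive; [trivial|unfold Rminus; ring].
  - exists (fun t => (2 * PI) * cos (2 * PI * (t - c))). split; [repeat constructor|].
    intros t. auto_derive; [trivial|unfold Rminus; ring].
  - exists (fun t => u' t + v' t). split; [now constructor|]. intros t.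
    apply (is_derive_plus (V := R_NormedModule)); auto.
  - exists (fun t => u' t * v t + u t * v' t). split; [now repeat constructor|].
    intros t. apply (is_derive_mult u v); auto. intros; apply Rmult_comm.
  - exists (fun t => u' t * exp (u t)). split; [now repeat constructor|].
    intros t. apply (is_derive_comp exp u); [apply is_derive_exp|auto].
Qed.

Lemma smooth_expr_smooth c u : smooth_expr c u -> forall n x, ex_derive_n u n x.
Proof.
  intros Hu.
  assert (H : forall n, exists v, smooth_expr c v /\ forall x, Derive_n u n x = v x).
  { induction n as [|n (v & Sv & Ev)]; [now exists u|].
    destruct (smooth_expr_derive c v Sv) as (w & Sw & Dw). exists w. split; [exact Sw|].
    intros x. simpl. rewrite (Derive_ext _ v) by exact Ev. now apply is_derive_unique. }
  intros [|n] x; [exact I|]. destruct (H n) as (v & Sv & Ev).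
  destruct (smooth_expr_derive c v Sv) as (w & _ & Dw).
  apply (ex_derive_ext v); [intros; now rewrite Ev|]. now exists (w x).
Qed.

(** For [k = cos (2 * PI * d)] and large [lam], this positive function is large
    near [c] and at most 1 at circle distance more than [d] from [c]. *)
Definition peak_fun (c lam k t : R) : R := exp (lam * (cos (2 * PI * (t - c)) + - k)).

Lemma peak_smooth c lam k n x : ex_derive_n (peak_fun c lam k) n x.
Proof. apply (smooth_expr_smooth c). unfold peak_fun. repeat constructor. Qed.

Lemma peak_per c lam k : periodic1 (peak_fun c lam k).
Proof.
  intros x. unfold peak_fun.
  replace (2 * PI * (x + 1 - c)) with (2 * PI * (x - c) + 2 * PI) by ring.
  now rewrite cos_plus, cos_2PI, sin_2PI, Rmult_1_r, Rmult_0_r, Rminus_0_r.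
Qed.

Definition peak (c lam k : R) : ptest :=
  PTest (peak_fun c lam k) (peak_smooth c lam k) (peak_per c lam k).

Lemma ex_RInt_cont (u : R -> R) a b : (forall x, continuous u x) -> ex_RInt u a b.
Proof. intros H. apply (ex_RInt_continuous (V := R_CompleteNormedModule)). auto. Qed.

Lemma cont_mult (u v : R -> R) x :
  continuous u x -> continuous v x -> continuous (fun t => u t * v t) x.
Proof. apply (continuous_mult (K := R_AbsRing)). Qed.

Lemma RInt_lower (u : R -> R) K a b : a <= b -> (forall x, continuous u x) ->
  (forall x, a < x < b -> K <= u x) -> (b - a) * K <= RInt u a b.
Proof.
  intros Hab Cu Hu.
  replace ((b - a) * K) with (RInt (fun _ => K) a b)
    by (rewrite RInt_const; reflexivity).
  apply RInt_le; [exact Hab | apply ex_RInt_const | now apply ex_RInt_cont | exact Hu].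
Qed.

Lemma cos_near x y : Rabs x <= y -> y <= PI -> cos y <= cos x.
Proof.
  intros H1 H2. assert (H0 := Rabs_pos x).
  replace (cos x) with (cos (Rabs x))
    by (unfold Rabs; destruct (Rcase_abs x); [apply cos_neg|reflexivity]).
  apply cos_decr_1; lra.
Qed.

Lemma cos_far x y : 0 <= y -> y <= Rabs x -> Rabs x <= 2 * PI - y -> cos x <= cos y.
Proof.
  intros H0 H1 H2.
  replace (cos x) with (cos (Rabs x))
    by (unfold Rabs; destruct (Rcase_abs x); [apply cos_neg|reflexivity]).
  assert (HP := PI_RGT_0).
  destruct (Rle_dec (Rabs x) PI) as [H|H].
  - apply cos_decr_1; lra.
  - replace (cos (Rabs x)) with (cos (2 * PI - Rabs x)).
    + apply cos_decr_1; lra.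
    + rewrite cos_minus, cos_2PI, sin_2PI. ring.
Qed.

(** The pairing with a sharp enough peak, placed next to [t0], where [h] is
    positive, has the sign of [h t0]. *)
Lemma exists_positive_pairing (h : R -> R) t0 :
  (forall x, continuous h x) -> in_T t0 -> 0 < h t0 ->
  exists p : ptest, 0 < RInt (fun t => h t * p t) 0 1.
Proof.
  intros Ch Ht0 Hpos. unfold in_T in Ht0.
  set (eps := h t0 / 2). assert (Heps : 0 < eps) by (unfold eps; lra).
  destruct (proj1 (filterlim_locally (F := locally t0) h (h t0)) (Ch t0) (mkposreal eps Heps))
    as (d0 & Hd0).
  (* The peak is centred at [t0 + d], not at [t0], so that the interval of radius [d]
     around the centre stays inside the period even when [t0 = 0]. *)
  set (d := Rmin d0 (1 - t0) / 4).
  assert (Hd : 0 < d /\ 4 * d <= d0 /\ 4 * d <= 1 - t0).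
  { assert (A := cond_pos d0). unfold d.
    assert (B := Rmin_l d0 (1 - t0)). assert (C := Rmin_r d0 (1 - t0)).
    assert (0 < Rmin d0 (1 - t0)) by (apply Rmin_glb_lt; lra). lra. }
  set (c := t0 + d).
  assert (Hin : forall t, Rabs (t - c) <= d -> eps <= h t).
  { intros t Ht. apply Rabs_le_between in Ht.
    assert (B : ball t0 d0 t).
    { change (Rabs (t - t0) < d0). apply Rabs_def1; unfold c in Ht; lra. }
    specialize (Hd0 t B). change (Rabs (h t - h t0) < eps) in Hd0.
    apply Rabs_def2 in Hd0. unfold eps in *. lra. }
  destruct (continuity_ab_min h 0 1) as (mx & Hm & Hmx); [lra| |].
  { intros x _. apply continuity_pt_filterlim, Ch. }
  set (M := Rabs (h mx)).
  assert (HM : forall t, 0 <= t <= 1 -> - M <= h t).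
  { intros t Ht. specialize (Hm t Ht). unfold M.
    assert (A := Rle_abs (- h mx)). rewrite Rabs_Ropp in A. lra. }
  assert (HM0 : 0 <= M) by apply Rabs_pos.
  assert (HP := PI_RGT_0).
  set (k := cos (2 * PI * d)). set (kap := cos (PI * d) - k).
  assert (Hkap : 0 < kap).
  { unfold kap, k. assert (cos (2 * PI * d) < cos (PI * d)); [|lra].
    apply cos_decreasing_1; nra. }
  (* With this exponent the central part of the peak outweighs the lower bound [- M]
     on the rest of the period. *)
  set (lam := M / (d * eps * kap)).
  assert (Hde : 0 < d * eps) by nra.
  assert (Hlam : 0 <= lam).
  { apply Rmult_le_pos; [exact HM0|]. left. apply Rinv_0_lt_compat.
    now apply Rmult_lt_0_compat. }
  exists (peak c lam k).
  assert (Cu : forall x, continuous (fun t => h t * peak c lam k t) x).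
  { intros x. apply cont_mult; [apply Ch|apply pt_continuous]. }
  assert (Abs2 : forall t, Rabs (2 * PI * (t - c)) = 2 * PI * Rabs (t - c)).
  { intros t. rewrite Rabs_mult, (Rabs_pos_eq (2 * PI)); lra. }
  assert (Out : forall t, 0 <= t <= 1 -> - M <= h t * peak c lam k t).
  { intros t Ht. simpl. unfold peak_fun. set (e := exp _).
    assert (He : 0 < e) by apply exp_pos.
    destruct (Rle_dec (Rabs (t - c)) d) as [H|H].
    - specialize (Hin t H). nra.
    - assert (e <= 1).
      { rewrite <- exp_0. unfold e.
        assert (cos (2 * PI * (t - c)) <= k); cycle 1.
        { destruct (Rle_lt_or_eq_dec (lam * (cos (2 * PI * (t - c)) + - k)) 0) as [Hlt|Heq];
            [nra|left; now apply exp_increasing|rewrite Heq; lra]. }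
        apply cos_far; [nra| |]; rewrite Abs2; [nra|].
        assert (Rabs (t - c) <= 1 - d) by (apply Rabs_le; unfold c; lra). nra. }
      specialize (HM t Ht). nra. }
  assert (Mid : forall t, Rabs (t - c) <= d / 2 ->
    eps * (1 + lam * kap) <= h t * peak c lam k t).
  { intros t Ht. specialize (Hin t ltac:(lra)). simpl. unfold peak_fun. set (e := exp _).
    assert (1 + lam * kap <= e).
    { unfold e. apply Rle_trans with (2 := exp_ineq1_le _).
      apply Rplus_le_compat_l, Rmult_le_compat_l; [exact Hlam|].
      unfold kap. assert (cos (PI * d) <= cos (2 * PI * (t - c))); [|lra].
      apply cos_near; [rewrite Abs2|]; nra. }
    assert (0 <= lam * kap) by nra.
    apply Rmult_le_compat; lra. }
  assert (E : d * (eps * (lam * kap)) = M) by (unfold lam; field; lra).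
  assert (I : forall a b, ex_RInt (fun t => h t * peak c lam k t) a b)
    by (intros; now apply ex_RInt_cont).
  rewrite <- (RInt_Chasles (V := R_CompleteNormedModule) _ 0 (c - d / 2) 1) by apply I.
  rewrite <- (RInt_Chasles (V := R_CompleteNormedModule) _ (c - d / 2) (c + d / 2) 1) by apply I.
  assert (H1 : (c - d / 2 - 0) * - M <= RInt (fun t => h t * peak c lam k t) 0 (c - d / 2)).
  { apply RInt_lower; [unfold c; lra|exact Cu|]. intros x Hx. apply Out. unfold c in Hx; lra. }
  assert (H2 : (c + d / 2 - (c - d / 2)) * (eps * (1 + lam * kap)) <=
     RInt (fun t => h t * peak c lam k t) (c - d / 2) (c + d / 2)).
  { apply RInt_lower; [lra|exact Cu|]. intros x Hx. apply Mid. apply Rabs_le. lra. }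
  assert (H3 : (1 - (c + d / 2)) * - M <= RInt (fun t => h t * peak c lam k t) (c + d / 2) 1).
  { apply RInt_lower; [unfold c; lra|exact Cu|]. intros x Hx. apply Out. unfold c in Hx; lra. }
  unfold plus; simpl in *. nra.
Qed.

Lemma test_functions_separate (h : R -> R) :
  (forall x, continuous h x) ->
  (forall p : ptest, RInt (fun t => h t * p t) 0 1 = 0) ->
  forall t, in_T t -> h t = 0.
Proof.
  intros Ch H t Ht.
  destruct (Rtotal_order (h t) 0) as [Hn|[E|Hp]]; [exfalso|exact E|exfalso].
  - destruct (exists_positive_pairing (fun t => - h t) t) as (p & Pp);
      [intros x; apply (continuous_opp (V := R_NormedModule)), Ch|exact Ht|lra|].
    rewrite (RInt_ext _ (fun t => opp (h t * p t))) in Pp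
      by (intros; unfold opp; simpl; ring).
    rewrite (RInt_opp (V := R_CompleteNormedModule)) in Pp.
    + rewrite H in Pp. unfold opp in Pp; simpl in Pp. lra.
    + apply ex_RInt_cont. intros x. apply cont_mult; [apply Ch|apply pt_continuous].
  - destruct (exists_positive_pairing h t Ch Ht) as (p & Pp); [lra|].
    rewrite H in Pp. lra.
Qed.

(** * The Green function on one period *)

Lemma Dop_iter_inv (alpha : R) (Ha : 0 < alpha) N u :
  Dop alpha N (Nat.iter N (Dop1_inv alpha Ha) u) = u.
Proof.
  unfold Dop. revert u. induction N as [|N IH]; intros u; [reflexivity|].
  rewrite Nat.iter_succ_r, Nat.iter_succ, Dop1_invK. apply IH.
Qed.

Lemma green_iter (alpha : R) (Ha : 0 < alpha) N :
  green alpha N = Nat.iter N (Dop1_inv alpha Ha) dirac_comb.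
Proof.
  destruct (Dop_bijective alpha N Ha dirac_comb) as (v & _ & U).
  rewrite <- (U _ (Dop_iter_inv alpha Ha N dirac_comb)).
  symmetry. apply U. now apply Dop_invK.
Qed.

Lemma is_derive_exp_lin a x : is_derive (fun s => exp (- a * s)) x (- a * exp (- a * x)).
Proof. auto_derive; [trivial|ring]. Qed.

Lemma cont_exp_lin a x : continuous (fun s => exp (- a * s)) x.
Proof.
  apply (ex_derive_continuous (V := R_NormedModule)). eexists; apply is_derive_exp_lin.
Qed.

Lemma cont_plus (u v : R -> R) x :
  continuous u x -> continuous v x -> continuous (fun t => u t + v t) x.
Proof. apply (continuous_plus (V := R_NormedModule)). Qed.

(** With [x = adj_inv p], the equation [x' = alpha * x - p] gives
    [(exp (- alpha * s) * q * x)' = exp (- alpha * s) * (k * x - q * p)]; integrate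
    over the period and use that [x] is periodic. *)
Lemma adj_parts (alpha : R) (Ha : 0 < alpha) (q k : R -> R) (p : ptest) :
  (forall x, is_derive q x (k x)) -> (forall x, continuous k x) ->
  RInt (fun s => exp (- alpha * s) * q s * p s) 0 1 =
  RInt (fun s => exp (- alpha * s) * k s * adj_inv alpha Ha p s) 0 1
  + (q 0 - exp (- alpha) * q 1) * adj_inv alpha Ha p 0.
Proof.
  intros Dq Ck. set (x := adj_inv alpha Ha p).
  assert (Cq : forall s, continuous q s).
  { intros s. apply (ex_derive_continuous (V := R_NormedModule)). now exists (k s). }
  set (A := fun s => exp (- alpha * s) * k s * x s).
  set (B := fun s => exp (- alpha * s) * q s * p s).
  assert (CA : forall s, continuous A s).
  { intros s. apply cont_mult; [apply cont_mult|apply pt_continuous]; [apply cont_exp_lin|apply Ck]. }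
  assert (CB : forall s, continuous B s).
  { intros s. apply cont_mult; [apply cont_mult|apply pt_continuous]; [apply cont_exp_lin|apply Cq]. }
  assert (H : is_RInt (fun s => minus (A s) (B s)) 0 1
    (minus (exp (- alpha * 1) * q 1 * x 1) (exp (- alpha * 0) * q 0 * x 0))).
  { apply (is_RInt_derive (V := R_CompleteNormedModule) (fun s => exp (- alpha * s) * q s * x s)).
    - intros s _. evar_last.
      { apply (is_derive_mult (fun s => exp (- alpha * s) * q s) x).
        - apply (is_derive_mult (fun s => exp (- alpha * s)) q);
            [apply is_derive_exp_lin|apply Dq|intros; apply Rmult_comm].
        - apply (adj_sol_derive alpha p).
        - intros; apply Rmult_comm. }
      unfold A, B, minus, plus, opp, mult; simpl. ring.
    - intros s _. apply (continuous_minus (V := R_NormedModule)); auto. }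
  apply (is_RInt_unique (V := R_CompleteNormedModule)) in H.
  rewrite (RInt_minus (V := R_CompleteNormedModule)) in H by now apply ex_RInt_cont.
  assert (E : x 1 = x 0) by (rewrite <- (pt_per x 0); f_equal; ring).
  rewrite E, Rmult_0_r, exp_0, Rmult_1_r in H.
  change (RInt A 0 1 + - RInt B 0 1 = exp (- alpha) * q 1 * x 0 + - (1 * q 0 * x 0)) in H.
  fold x A B. lra.
Qed.

(** The condition fixes the constant of integration, since [exp (- alpha)] is not 1. *)
Lemma antiderivative_jump (alpha j : R) (k : R -> R) : 0 < alpha ->
  (forall x, continuous k x) ->
  exists q, (forall x, is_derive q x (k x)) /\ q 0 - exp (- alpha) * q 1 = j.
Proof.
  intros Ha Ck. set (K := RInt k 0 1). set (e := exp (- alpha)).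
  assert (He : e < 1) by (unfold e; rewrite <- exp_0; apply exp_increasing; lra).
  exists (fun x => RInt k 0 x + (j + e * K) / (1 - e)). split.
  - intros x. replace (k x) with (plus (k x) 0) by apply Rplus_0_r.
    apply (is_derive_plus (V := R_NormedModule));
      [|apply (is_derive_const (V := R_NormedModule))].
    apply (is_derive_RInt k (fun x => RInt k 0 x) 0); [|apply Ck].
    apply filter_forall. intros s. apply (RInt_correct (V := R_CompleteNormedModule)).
    now apply ex_RInt_cont.
  - rewrite RInt_point. fold K. unfold zero; simpl. field. lra.
Qed.

(** Each inverse of [D + alpha Id] passes to the kernel by [adj_parts], its
    polynomial factor being replaced by an antiderivative.  The kernel of order 1
    jumps by 1 at the origin, which produces the Dirac comb; those of higher order
    have no jump. *)
Lemma green_kernel (alpha : R) n : 0 < alpha ->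
  exists q, polyfun (S n) q /\
    q 0 - exp (- alpha) * q 1 = (if n then 1 else 0) /\
    forall p : ptest, green alpha (S n) p = RInt (fun s => exp (- alpha * s) * q s * p s) 0 1.
Proof.
  intros Ha. induction n as [|n (k & Pk & _ & Hk)].
  - destruct (antiderivative_jump alpha 1 (fun _ => 0) Ha) as (q & Dq & Jq).
    { intros x. apply continuous_const. }
    exists q. split; [exists (fun _ => 0); split; [apply polyfun_zero|exact Dq]|].
    split; [exact Jq|]. intros p.
    rewrite (adj_parts alpha Ha q (fun _ => 0)), Jq, (green_iter alpha Ha);
      [|exact Dq|intros; apply continuous_const].
    rewrite (RInt_ext _ (fun _ => 0)), RInt_const by (intros; apply Rmult_eq_0_compat_r; ring).
    simpl. unfold scal; simpl; unfold mult; simpl. ring.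
  - assert (Ck : forall x, continuous k x) by (intros; now apply (polyfun_continuous (S n))).
    destruct (antiderivative_jump alpha 0 k Ha Ck) as (q & Dq & Jq).
    exists q. split; [exists k; now split|]. split; [exact Jq|]. intros p.
    rewrite (adj_parts alpha Ha q k), Jq by assumption.
    rewrite <- Hk, !(green_iter alpha Ha), (Nat.iter_succ (S n)). simpl. ring.
Qed.

(** [wrap x] is [x] modulo 1, for [-1 <= x < 1]. *)
Definition wrap (x : R) : R := if Rle_dec 0 x then x else x + 1.

Ltac wraps := unfold wrap, in_T in *; repeat destruct Rle_dec; try lra.

(** A translation of the test function is a periodic translation of the kernel:
    split the integral where [s + th] reaches the end of the period. *)
Lemma RInt_wrap (g : R -> R) (p : ptest) th : in_T th -> (forall x, continuous g x) ->
  RInt (fun s => g s * p (s + th)) 0 1 = RInt (fun s => g (wrap (s - th)) * p s) 0 1.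
Proof.
  intros Hth Cg. unfold in_T in Hth.
  assert (Cu : forall c x, continuous (fun s => g (s + c) * p s) x).
  { intros c x. apply cont_mult; [|apply pt_continuous].
    apply (continuous_comp (fun s => s + c) g); [|apply Cg].
    apply (continuous_plus (V := R_NormedModule)); [apply continuous_id|apply continuous_const]. }
  assert (Cv : forall x, continuous (fun s => g s * p (s + th)) x).
  { intros x. apply cont_mult; [apply Cg|]. apply (pt_continuous (pt_shift th p)). }
  assert (E : forall d a b, RInt (fun s => g (s + (- (th + d))) * p (s - d)) (a + (th + d)) (b + (th + d))
     = RInt (fun s => g s * p (s + th)) a b).
  { intros d a b.
    replace (a + (th + d)) with (1 * a + (th + d)) by ring.
    replace (b + (th + d)) with (1 * b + (th + d)) by ring.
    rewrite <- (RInt_comp_lin (V := R_CompleteNormedModule)).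
    - apply RInt_ext. intros s _.
      change (@eq R (1 * (g (1 * s + (th + d) + - (th + d)) * p (1 * s + (th + d) - d)))
        (g s * p (s + th))).
      rewrite Rmult_1_l. apply (f_equal2 Rmult); [apply (f_equal g)|apply (f_equal p)]; ring.
    - apply ex_RInt_cont. intros x. apply cont_mult.
      + apply (continuous_comp (fun s => s + - (th + d)) g); [|apply Cg].
        apply (continuous_plus (V := R_NormedModule)); [apply continuous_id|apply continuous_const].
      + apply (pt_continuous (pt_shift (- d) p)). }
  assert (P1 : forall s : R, p (s - -1) = p s).
  { intros s. replace (s - -1) with (s + 1) by ring. apply pt_per. }
  assert (I1 : is_RInt (fun s => g (wrap (s - th)) * p s) 0 th
                 (RInt (fun s => g s * p (s + th)) (1 - th) 1)).
  { rewrite <- (E (-1) (1 - th) 1).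
    replace (1 - th + (th + -1)) with 0 by ring. replace (1 + (th + -1)) with th by ring.
    apply (is_RInt_ext (fun s => g (s + - (th + -1)) * p (s - -1))).
    - intros s. rewrite Rmin_left, Rmax_right by lra. intros Hs.
      rewrite P1. f_equal. f_equal. wraps.
    - apply (RInt_correct (V := R_CompleteNormedModule)), ex_RInt_cont.
      intros x. apply (continuous_ext (fun s => g (s + - (th + -1)) * p s)); [|apply Cu].
      intros s. now rewrite P1. }
  assert (I2 : is_RInt (fun s => g (wrap (s - th)) * p s) th 1
                 (RInt (fun s => g s * p (s + th)) 0 (1 - th))).
  { rewrite <- (E 0 0 (1 - th)).
    replace (0 + (th + 0)) with th by ring. replace (1 - th + (th + 0)) with 1 by ring.
    apply (is_RInt_ext (fun s => g (s + - (th + 0)) * p (s - 0))).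
    - intros s. rewrite Rmin_left, Rmax_right by lra. intros Hs.
      f_equal; f_equal; wraps.
    - apply (RInt_correct (V := R_CompleteNormedModule)), ex_RInt_cont.
      intros x. apply (continuous_ext (fun s => g (s + - (th + 0)) * p s)); [|apply Cu].
      intros s. now rewrite Rminus_0_r. }
  rewrite (is_RInt_unique _ _ _ _ (is_RInt_Chasles _ _ _ _ _ _ I1 I2)).
  rewrite <- (RInt_Chasles (V := R_CompleteNormedModule) _ 0 (1 - th) 1)
    by now apply ex_RInt_cont.
  apply Rplus_comm.
Qed.

(** The function [wrap] jumps from 1 to 0, where [g] takes the same value.  The expression
    for [G] needs no case distinction, which makes its continuity evident. *)
Lemma wrap_continuous (g : R -> R) th : (forall x, continuous g x) -> g 0 = g 1 ->
  exists G, (forall x, continuous G x) /\ forall s, G s = g (wrap (s - th)).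
Proof.
  intros Cg E. exists (fun s => g (Rmax (s - th) 0) + g (Rmin (s - th) 0 + 1) + - g 1). split.
  - assert (A : forall x, continuous (fun s => s - th) x).
    { intros x. apply (continuous_minus (V := R_NormedModule));
        [apply continuous_id|apply continuous_const]. }
    assert (B : forall x, continuous (fun s => Rabs (s - th)) x).
    { intros x. apply (continuous_comp (fun s => s - th) Rabs); [apply A|apply continuous_Rabs]. }
    intros x. repeat apply cont_plus; [| |apply continuous_const].
    + apply (continuous_comp (fun s => Rmax (s - th) 0) g); [|apply Cg].
      apply (continuous_ext (fun s => ((s - th) + Rabs (s - th)) * / 2)).
      * intros s. unfold Rmax, Rabs. destruct Rle_dec, Rcase_abs; simpl; lra.
      * apply cont_mult; [apply cont_plus; auto|apply continuous_const].
    + apply (continuous_comp (fun s => Rmin (s - th) 0 + 1) g); [|apply Cg].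
      apply (continuous_ext (fun s => ((s - th) + - Rabs (s - th)) * / 2 + 1)).
      * intros s. unfold Rmin, Rabs. destruct Rle_dec, Rcase_abs; simpl; lra.
      * apply cont_plus; [|apply continuous_const]. apply cont_mult; [|apply continuous_const].
        apply cont_plus; [auto|]. apply (continuous_opp (V := R_NormedModule)), B.
  - intros s. unfold wrap. destruct Rle_dec.
    + rewrite Rmax_left, Rmin_right, Rplus_0_l by lra. apply Rplus_minus_r.
    + rewrite Rmax_right, Rmin_left by lra. rewrite E. apply Rplus_minus_l.
Qed.

Lemma pd_sum_apply (u : nat -> pdist) (p : ptest) L :
  (sum_n_m u 1 L : pdist) p = sum_n_m (fun l => u l p) 1 L.
Proof.
  induction L as [|L IH].
  - rewrite !sum_n_m_zero by lia. reflexivity.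
  - rewrite !sum_n_Sm by lia. simpl. now rewrite IH.
Qed.

Lemma sum_continuous (G : nat -> R -> R) L x :
  (forall l, (1 <= l <= L)%nat -> continuous (G l) x) ->
  continuous (fun s => sum_n_m (fun l => G l s) 1 L) x.
Proof.
  induction L as [|L IH]; intros H.
  - apply (continuous_ext (fun _ => 0)); [|apply continuous_const].
    intros s. now rewrite sum_n_m_zero by lia.
  - apply (continuous_ext (fun s => sum_n_m (fun l => G l s) 1 L + G (S L) s)).
    + intros s. now rewrite sum_n_Sm by lia.
    + apply cont_plus; [apply IH; intros; apply H; lia|apply H; lia].
Qed.

Lemma RInt_sum (G : nat -> R -> R) L :
  (forall l, (1 <= l <= L)%nat -> forall x, continuous (G l) x) ->
  RInt (fun s => sum_n_m (fun l => G l s) 1 L) 0 1 =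
  sum_n_m (fun l => RInt (G l) 0 1) 1 L.
Proof.
  induction L as [|L IH]; intros H.
  - rewrite sum_n_m_zero by lia.
    rewrite (RInt_ext _ (fun _ => 0)), RInt_const; [apply Rmult_0_r|].
    intros s _. now rewrite sum_n_m_zero by lia.
  - rewrite sum_n_Sm by lia.
    rewrite (RInt_ext _ (fun s => plus (sum_n_m (fun l => G l s) 1 L) (G (S L) s)))
      by (intros; now rewrite sum_n_Sm by lia).
    rewrite (RInt_plus (V := R_CompleteNormedModule)), IH; [reflexivity| | |].
    + intros; apply H; lia.
    + apply ex_RInt_cont. intros x. apply sum_continuous. intros; apply H; lia.
    + apply ex_RInt_cont. apply H; lia.
Qed.

Lemma spline_formula (alpha : R) n L (beta theta : nat -> R) (f : pcont) :
  0 < alpha -> (forall l, (1 <= l <= L)%nat -> in_T (theta l)) ->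
  pd_of_fun f =
    sum_n_m (fun l => scal (beta l) (pd_translate (theta l) (green alpha (S (S n))))) 1 L ->
  exists q, polyfun (S (S n)) q /\ forall t, in_T t ->
    f t = sum_n_m (fun l => beta l * (exp (- alpha * wrap (t - theta l))
                                        * q (wrap (t - theta l)))) 1 L.
Proof.
  intros Ha Hth Hf. destruct (green_kernel alpha (S n) Ha) as (q & Pq & Jq & Hq).
  exists q. split; [exact Pq|].
  set (g := fun s => exp (- alpha * s) * q s).
  assert (Cg : forall x, continuous g x).
  { intros x. apply cont_mult; [apply cont_exp_lin|now apply (polyfun_continuous (S (S n)))]. }
  assert (Eg : g 0 = g 1).
  { unfold g. rewrite Rmult_0_r, exp_0, Rmult_1_r. lra. }
  assert (CG : forall l x, continuous (fun s => g (wrap (s - theta l))) x).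
  { intros l x. destruct (wrap_continuous g (theta l) Cg Eg) as (G & CG & EG).
    now apply (continuous_ext G). }
  set (S := fun s => sum_n_m (fun l => beta l * g (wrap (s - theta l))) 1 L).
  assert (CS : forall x, continuous S x).
  { intros x. apply (sum_continuous (fun l s => beta l * g (wrap (s - theta l)))).
    intros l _. apply cont_mult; [apply continuous_const|apply CG]. }
  assert (Z : forall t, in_T t -> f t + - S t = 0).
  { apply (test_functions_separate (fun t => f t + - S t)).
    - intros x. apply cont_plus; [apply pc_cont|].
      apply (continuous_opp (V := R_NormedModule)), CS.
    - intros p.
      assert (E : RInt (fun t => f t * p t) 0 1 = RInt (fun t => S t * p t) 0 1).
      { transitivity (pd_of_fun f p); [reflexivity|]. rewrite Hf, pd_sum_apply.
        rewrite (RInt_ext (fun t => S t * p t)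
          (fun t => sum_n_m (fun l => beta l * (g (wrap (t - theta l)) * p t)) 1 L)).
        - rewrite (RInt_sum (fun l t => beta l * (g (wrap (t - theta l)) * p t))).
          + apply sum_n_m_ext_loc. intros l Hl. simpl. rewrite Hq.
            change (beta l * RInt (fun s => g s * p (s + theta l)) 0 1 =
              RInt (fun t => beta l * (g (wrap (t - theta l)) * p t)) 0 1).
            rewrite (RInt_wrap g p (theta l)) by auto.
            symmetry. apply (RInt_scal (V := R_CompleteNormedModule)).
            apply ex_RInt_cont. intros x. apply cont_mult; [apply CG|apply pt_continuous].
          + intros l _ x. apply cont_mult; [apply continuous_const|].
            apply cont_mult; [apply CG|apply pt_continuous].
        - intros t _. unfold S. rewrite Rmult_comm.
          rewrite <- (sum_n_m_mult_l (K := R_Ring)). apply sum_n_m_ext. intros l.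
          unfold mult; simpl. ring. }
      rewrite (RInt_ext _ (fun t => minus (f t * p t) (S t * p t)))
        by (intros; unfold minus, plus, opp; simpl; ring).
      rewrite (RInt_minus (V := R_CompleteNormedModule)), E.
      + apply (minus_eq_zero (G := R_AbelianGroup)).
      + apply pc_ex_RInt.
      + apply ex_RInt_cont. intros x. apply cont_mult; [apply CS|apply pt_continuous]. }
  intros t Ht. specialize (Z t Ht). change (f t = S t). lra.
Qed.

(** * Saturation points on one arc *)

Lemma extremum_derive (F : R -> R) s b d : 0 < s < b -> is_derive F s d ->
  (forall x, 0 < x < b -> Rabs (F x) <= 1) -> Rabs (F s) = 1 -> d = 0.
Proof.
  intros Hs D B E.
  assert (pr : derivable_pt_lim F s d) by (now apply is_derive_Reals).
  change d with (derive_pt F s (exist _ d pr)).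
  destruct (Rle_dec 0 (F s)) as [H|H].
  - apply (deriv_maximum F 0 b); try lra. intros x H1 H2.
    rewrite Rabs_pos_eq in E by lra. rewrite E.
    apply Rle_trans with (1 := Rle_abs _). now apply B.
  - apply (deriv_minimum F 0 b); try lra. intros x H1 H2.
    specialize (B x (conj H1 H2)). apply Rabs_le_between in B.
    rewrite Rabs_left in E by lra. lra.
Qed.

(** The points of [ss] are local extrema, thus roots of [Q' - alpha * Q].  With more
    than [n] of them this polynomial vanishes, [Q] is an eigenfunction of the
    derivative, and [Q = 0] contradicts the modulus 1 at any point of [ss]. *)
Lemma arc_count (alpha : R) n (Q : R -> R) ss : 0 < alpha -> polyfun (S n) Q -> NoDup ss ->
  (forall s, In s ss -> 0 < s /\ Rabs (exp (- alpha * s) * Q s) = 1 /\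
     exists b, s < b /\ forall x, 0 < x < b -> Rabs (exp (- alpha * x) * Q x) <= 1) ->
  (length ss <= n)%nat.
Proof.
  intros Ha PQ Nd H. destruct (Nat.le_gt_cases (length ss) n) as [|Hl]; [assumption|exfalso].
  destruct PQ as (Q' & PQ' & DQ).
  assert (DF : forall s, is_derive (fun s => exp (- alpha * s) * Q s) s
                 (exp (- alpha * s) * (Q' s + - alpha * Q s))).
  { intros s. evar_last.
    { apply (is_derive_mult (fun s => exp (- alpha * s)) Q);
        [apply is_derive_exp_lin|apply DQ|intros; apply Rmult_comm]. }
    unfold plus, mult; simpl. ring. }
  assert (Z : forall x, Q' x + - alpha * Q x = 0).
  { apply (polyfun_roots (S n) _ ss); [|exact Nd|lia|].
    - apply polyfun_plus; [now apply polyfun_S|]. apply polyfun_scal. now exists Q'.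
    - intros s Is. destruct (H s Is) as (H0 & H1 & b & Hb & B).
      assert (E := extremum_derive _ s b _ (conj H0 Hb) (DF s) B H1).
      apply Rmult_integral in E. destruct E as [E|E]; [|exact E].
      assert (P := exp_pos (- alpha * s)). lra. }
  assert (Q0 : forall x, Q x = 0).
  { apply (polyfun_eigen (S n) alpha); [lra|now exists Q'|].
    intros x. replace (alpha * Q x) with (Q' x) by (specialize (Z x); lra). apply DQ. }
  destruct ss as [|s ss]; [simpl in Hl; lia|].
  destruct (H s (or_introl eq_refl)) as (_ & H1 & _).
  rewrite Q0, Rmult_0_r, Rabs_R0 in H1. lra.
Qed.

Lemma sup_norm_bound (f : R -> R) t : sup_norm f = Finite 1 -> in_T t -> Rabs (f t) <= 1.
Proof.
  intros Hs Ht.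
  destruct (Lub_Rbar_correct (fun y => exists t, in_T t /\ y = Rabs (f t))) as (U & _).
  unfold sup_norm in Hs. rewrite Hs in U. apply (U (Rabs (f t))). now exists t.
Qed.

(** The knot [theta m] lies behind [theta l] by [wrap (theta l - theta m)], so the
    inequality says that the point at offset [s] from [theta l] is reached before
    the next passage through [theta m]. *)
Definition on_arc (theta : nat -> R) L l s : Prop :=
  forall m, (1 <= m <= L)%nat -> s + wrap (theta l - theta m) < 1.

(** The knot nearest behind [t] will do: another knot met on the way from it to
    [t] would be nearer. *)
Lemma on_arc_cover (theta : nat -> R) L t : (1 <= L)%nat ->
  (forall l, (1 <= l <= L)%nat -> in_T (theta l)) -> in_T t ->
  exists l, (1 <= l <= L)%nat /\ on_arc theta L l (wrap (t - theta l)).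
Proof.
  intros HL Hth Ht. destruct (argmin (fun l => wrap (t - theta l)) L HL) as (l & Hl & Ml).
  exists l. split; [exact Hl|]. intros m Hm. specialize (Ml m Hm).
  assert (A := Hth l Hl). assert (B := Hth m Hm). wraps.
Qed.

(** No knot is crossed on an arc, so offsets from different knots differ by a
    constant.  This is why one analytic formula holds on the whole arc. *)
Lemma on_arc_wrap (theta : nat -> R) L l m t :
  (forall l, (1 <= l <= L)%nat -> in_T (theta l)) -> in_T t ->
  (1 <= l <= L)%nat -> (1 <= m <= L)%nat ->
  on_arc theta L l (wrap (t - theta l)) ->
  wrap (t - theta m) = wrap (t - theta l) + wrap (theta l - theta m).
Proof.
  intros Hth Ht Hl Hm A. specialize (A m Hm).
  assert (B := Hth l Hl). assert (C := Hth m Hm). wraps.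
Qed.

Lemma on_arc_open (theta : nat -> R) L l s : on_arc theta L l s ->
  exists b, s < b /\ forall x, x < b -> on_arc theta L l x.
Proof.
  unfold on_arc. induction L as [|L IH]; intros H.
  - exists (s + 1). split; [lra|]. intros; lia.
  - destruct IH as (b & Hb & B); [intros; apply H; lia|].
    specialize (H (S L) ltac:(lia)).
    exists (Rmin b (1 - wrap (theta l - theta (S L)))). split; [apply Rmin_glb_lt; lra|].
    intros x Hx m Hm.
    assert (M1 := Rmin_l b (1 - wrap (theta l - theta (S L)))).
    assert (M2 := Rmin_r b (1 - wrap (theta l - theta (S L)))).
    destruct (Nat.eq_dec m (S L)) as [->|]; [lra|]. apply B; [lra|lia].
Qed.

Theorem mainTheorem4 :
  forall (alpha : R) (N : nat), 0 < alpha -> (2 <= N)%nat ->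
  forall (L : nat), (1 <= L)%nat ->
  forall (beta theta : nat -> R),
    (forall l, (1 <= l <= L)%nat -> in_T (theta l)) ->
  forall f : pcont,
    pd_of_fun f =
      sum_n_m (fun l => scal (beta l) (pd_translate (theta l) (green alpha N))) 1 L ->
    sup_norm f = Finite 1 ->
  exists pts : list R,
    NoDup pts /\
    (forall t, In t pts <-> saturation f t) /\
    (length pts <= L * N)%nat.
Proof.
  intros alpha [|[|n]] Ha HN L HL beta theta Hth f Hf Hs; [lia|lia|].
  destruct (spline_formula alpha n L beta theta f Ha Hth Hf) as (q & Pq & Fq).
  apply finite_of_bound. intros ts Nd Sat.
  apply (length_cover
    (fun l t => saturation f t /\ on_arc theta L l (wrap (t - theta l)))); [|exact Nd|].
  2:{ intros t It. destruct (Sat t It) as [Tt Et].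
      destruct (on_arc_cover theta L t HL Hth Tt) as (l & Hl & Al). exists l.
      exact (conj Hl (conj (conj Tt Et) Al)). }
  clear ts Nd Sat. intros l ts Hl Nd Hts.
  assert (Hthl := Hth l Hl).
  (* On the arc after [theta l], the offset from [theta m] exceeds that from
     [theta l] by [c m]; the factor [exp (- alpha * c m)] is moved into [Q]. *)
  set (c := fun m => wrap (theta l - theta m)).
  set (Q := fun s => sum_n_m (fun m => (beta m * exp (- alpha * c m)) * q (s + c m)) 1 L).
  assert (PQ : polyfun (S (S n)) Q).
  { apply (polyfun_sum (S (S n)) (fun m => beta m * exp (- alpha * c m))
      (fun m s => q (s + c m))).
    intros m. now apply polyfun_shift. }
  assert (FQ : forall t, in_T t -> on_arc theta L l (wrap (t - theta l)) ->
    f t = exp (- alpha * wrap (t - theta l)) * Q (wrap (t - theta l))).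
  { intros t Ht At. rewrite Fq by exact Ht. unfold Q.
    rewrite <- (sum_n_m_mult_l (K := R_Ring)). apply sum_n_m_ext_loc. intros m Hm.
    rewrite (on_arc_wrap theta L l m t) by assumption. fold (c m).
    rewrite Rmult_plus_distr_l, exp_plus. unfold mult; simpl. ring. }
  assert (BQ : forall x, 0 <= x -> on_arc theta L l x -> Rabs (exp (- alpha * x) * Q x) <= 1).
  { intros x H0 Ax.
    assert (H1 := Ax l Hl).
    (* The arc may run past the end of the period. *)
    set (t := if Rlt_dec (theta l + x) 1 then theta l + x else theta l + x - 1).
    assert (Ht : in_T t /\ wrap (t - theta l) = x).
    { unfold t. destruct Rlt_dec; split; wraps. }
    destruct Ht as [Ht Et]. rewrite <- Et. rewrite <- FQ; [|exact Ht|now rewrite Et].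
    now apply sup_norm_bound. }
  (* The knot itself, where [f] may have a kink, is counted apart. *)
  set (d := fun t => if Req_EM_T t (theta l) then false else true).
  assert (Len : (length ts <= 1 + length (filter d ts))%nat).
  { rewrite <- (filter_length d ts).
    enough (length (filter (fun x => negb (d x)) ts) <= length (theta l :: nil))%nat
      by (simpl in *; lia).
    apply NoDup_incl_length; [now apply NoDup_filter|].
    intros t [_ Ht]%filter_In. unfold d in Ht. destruct Req_EM_T; [now left|easy]. }
  enough (length (map (fun t => wrap (t - theta l)) (filter d ts)) <= S n)%nat
    by (rewrite length_map in *; lia).
  apply (arc_count alpha (S n) Q _ Ha PQ).
  - apply NoDup_map_NoDup_ForallPairs; [|now apply NoDup_filter].
    intros t u [It _]%filter_In [Iu _]%filter_In E.
    destruct (Hts t It) as [[Ht _] _], (Hts u Iu) as [[Hu _] _]. wraps.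
  - intros s [t [<- [It Dt]%filter_In]]%in_map_iff.
    destruct (Hts t It) as [[Ht Et] At].
    split; [|split].
    + unfold d in Dt. destruct Req_EM_T; [easy|]. wraps.
    + now rewrite <- FQ.
    + destruct (on_arc_open theta L l _ At) as (b & Hb & B).
      exists b. split; [exact Hb|]. intros x Hx. apply BQ; [lra|]. apply B; lra.
Qed.
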